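(* Let $(X,p)$ be a complete partial metric space. Suppose that the mapping $F : X\times X \rightarrow X$ satisfies, for all $x,y,u,v\in X$, \[ p(F(x,y),F(u,v))\leq k\,p(x,u)+l\,p(y,v), \] where $k,l$ are nonnegative real constants with $k+l<1$. Then $F$ has a unique coupled fixed point.
   Context: A partial metric on a nonempty set $X$ is a function $p:X\times X\to[0,+\infty)$ such that for all $x,y,z\in X$: (p1) $x=y$ if and only if $p(x,x)=p(x,y)=p(y,y)$; (p2) $p(x,x)\leq p(x,y)$; (p3) $p(x,y)=p(y,x)$; (p4) $p(x,y)\leq p(x,z)+p(z,y)-p(z,z)$. A partial metric space is a pair $(X,p)$ with $X$ a nonempty set and $p$ a partial metric on $X$. A sequence $\{x_n\}$ in $X$ converges to $x\in X$ if $p(x,x)=\lim_{n\to+\infty}p(x,x_n)$. A sequence $\{x_n\}$ is Cauchy if $\lim_{n,m\to+\infty}p(x_n,x_m)$ exists and is finite. $(X,p)$ is complete if every Cauchy sequence $\{x_n\}$ in $X$ converges to a point $x\in X$ with $p(x,x)=\lim_{n,m\to+\infty}p(x_n,x_m)$. A coupled fixed point of $F:X\times X\to X$ is an element $(x,y)\in X\times X$ with $F(x,y)=x$ and $F(y,x)=y$. *)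

(* Defs.v *)
From mathcomp Require Import all_boot all_order all_algebra.
From mathcomp Require Import all_classical all_reals all_analysis.
Set Implicit Arguments.
Unset Strict Implicit.
Unset Printing Implicit Defensive.
Import Order.TTheory GRing.Theory Num.Theory numFieldNormedType.Exports.
Local Open Scope classical_set_scope.
Local Open Scope ring_scope.

(* The carrier [X] is a bare type: its nonemptiness is part of
   [partial_metric_space], and no topology on [X] is assumed. *)

Record partial_metric (R : realType) (X : Type) (p : X -> X -> R) : Prop := {
  pmetric_ge0 : forall x y, 0 <= p x y;
  pmetric_eq : forall x y, x = y <-> p x x = p x y /\ p x y = p y y;
  pmetric_self_le : forall x y, p x x <= p x y;
  pmetric_sym : forall x y, p x y = p y x;
  pmetric_triangle : forall x y z, p x y <= p x z + p z y - p z z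
}.

Definition partial_metric_space (R : realType) (X : Type) (p : X -> X -> R) :=
  inhabited X /\ partial_metric p.

Definition pmetric_cvg (R : realType) (X : Type) (p : X -> X -> R)
    (u : nat -> X) (x : X) : Prop :=
  p x (u n) @[n --> \oo] --> p x x.

(* The double limit is taken along the product filter: both indices tend to
   infinity independently. *)
Definition pmetric_dlim (R : realType) (X : Type) (p : X -> X -> R)
    (u : nat -> X) (l : R) : Prop :=
  p (u nm.1) (u nm.2) @[nm --> (\oo, \oo)] --> l.

(* [l] ranges over [R], so the limit is finite. *)
Definition pmetric_cauchy (R : realType) (X : Type) (p : X -> X -> R)
    (u : nat -> X) : Prop :=
  exists l : R, pmetric_dlim p u l.

Definition pmetric_complete (R : realType) (X : Type) (p : X -> X -> R) : Prop :=
  forall u : nat -> X, pmetric_cauchy p u ->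
    exists x : X, pmetric_cvg p u x /\ pmetric_dlim p u (p x x).

Definition coupled_fixed_point (X : Type) (F : X * X -> X) (z : X * X) : Prop :=
  F (z.1, z.2) = z.1 /\ F (z.2, z.1) = z.2.

(* Main.v *)
Require Import Defs.
From mathcomp Require Import all_boot all_order all_algebra.
From mathcomp Require Import all_classical all_reals all_analysis.
From mathcomp Require Import ring lra.
Set Implicit Arguments.
Unset Strict Implicit.
Unset Printing Implicit Defensive.
Import Order.TTheory GRing.Theory Num.Theory numFieldNormedType.Exports.
Local Open Scope classical_set_scope.
Local Open Scope ring_scope.

(** A coupled fixed point of [F] is a fixed point of the map
    [(x, y) |-> (F (x, y), F (y, x))] on [X * X].  For the partial metric
    [p x u + p y v] on [X * X], adding the hypothesis at [(x, y), (u, v)] to the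
    hypothesis at [(y, x), (v, u)] shows that this map is a contraction of ratio
    [k + l < 1]; so everything follows from the Banach principle for partial
    metrics ([contraction_unique_fixpoint]).

    Completeness does not obviously pass to the product, because convergence of
    a sum does not by itself give convergence of the summands.  Orbits of a
    contraction, however, are Cauchy with double limit [0], and a double limit
    [0] does split, the summands being nonnegative.  The Banach principle is
    therefore proved from completeness for these sequences only
    ([zero_complete]), which is inherited by the product ([zero_complete_sum]). *)

Definition zero_complete (R : realType) (X : Type) (p : X -> X -> R) : Prop :=
  forall u : nat -> X, pmetric_dlim p u 0 ->
    exists x : X, p x x = 0 /\ pmetric_cvg p u x.

Definition sum_pmetric (R : realType) (X Y : Type)
    (p : X -> X -> R) (q : Y -> Y -> R) (z w : X * Y) : R :=
  p z.1 w.1 + q z.2 w.2.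

Section PartialMetric.
Variables (R : realType) (X : Type) (p : X -> X -> R).

Lemma complete_zero_complete : pmetric_complete p -> zero_complete p.
Proof.
move=> hc u u0; have [x [ux uxx]] := hc u (ex_intro _ 0 u0).
by exists x; split=> //; exact: (cvg_unique _ uxx u0).
Qed.

Hypothesis hp : partial_metric p.

(** Points are separated through their self-distances, and distance [0] forces
    both self-distances to vanish because it bounds them. *)
Lemma pmetric0_eq x y : p x y = 0 -> x = y.
Proof.
move=> pxy0; apply/(pmetric_eq hp).
have := pmetric_self_le hp x y; have := pmetric_self_le hp y x.
have := pmetric_ge0 hp x x; have := pmetric_ge0 hp y y.
by rewrite (pmetric_sym hp y x) pxy0; split; lra.
Qed.

Lemma pmetric_weak_triangle x y z : p x y <= p x z + p z y.
Proof. by have := pmetric_triangle hp x y z; have := pmetric_ge0 hp z z; lra. Qed.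

Section Contraction.
Variables (T : X -> X) (c : R).
Hypotheses (c_ge0 : 0 <= c) (c_lt1 : c < 1).
Hypothesis hT : forall x y, p (T x) (T y) <= c * p x y.

Lemma contraction_iter n x y : p (iter n T x) (iter n T y) <= c ^+ n * p x y.
Proof.
elim: n => [|n IHn] /=; first by rewrite expr0 mul1r.
by apply: le_trans (hT _ _) _; rewrite exprS -mulrA ler_wpM2l.
Qed.

(** The bound is the solution [M] of [M = p x (T x) + c * M], the recursion
    obtained by passing through [T x] and contracting once. *)
Lemma orbit_bounded x n : p x (iter n T x) <= p x (T x) / (1 - c).
Proof.
set M := _ / _.
have ME : M = p x (T x) + c * M by rewrite /M; field; rewrite subr_eq0 gt_eqF.
elim: n => [|n IHn] /=.
  have M_ge0 : 0 <= M by rewrite divr_ge0 ?(pmetric_ge0 hp)// subr_ge0 ltW.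
  rewrite ME; apply: le_trans (pmetric_self_le hp x (T x)) _.
  by rewrite lerDl mulr_ge0.
rewrite ME; apply: le_trans (pmetric_weak_triangle _ _ (T x)) _.
by rewrite lerD2l; apply: le_trans (hT _ _) _; rewrite ler_wpM2l.
Qed.

(** The sum of the two powers stands in for [c ^+ minn n m]: it is symmetric
    and its limit along the product filter is immediate. *)
Lemma orbit_dist_le x n m :
  p (iter n T x) (iter m T x) <= (c ^+ n + c ^+ m) * (p x (T x) / (1 - c)).
Proof.
set M := _ / _.
have M_ge0 : 0 <= M by rewrite divr_ge0 ?(pmetric_ge0 hp)// subr_ge0 ltW.
wlog le_nm : n m / (n <= m)%N.
  move=> H; case: (leqP n m) => [|/ltnW]; first exact: H.
  by rewrite (pmetric_sym hp) addrC; exact: H.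
rewrite -(subnKC le_nm) iterD; apply: le_trans (contraction_iter _ _ _) _.
rewrite mulrDl; apply: (@le_trans _ _ (c ^+ n * M)).
  by rewrite ler_wpM2l ?exprn_ge0// orbit_bounded.
by rewrite lerDl mulr_ge0 ?exprn_ge0.
Qed.

Lemma orbit_dlim0 x : pmetric_dlim p (fun n => iter n T x) 0.
Proof.
have c0 : c ^+ n @[n --> \oo] --> (0 : R).
  by apply: cvg_expr; rewrite ger0_norm.
have lim0 : (c ^+ nm.1 + c ^+ nm.2) * (p x (T x) / (1 - c))
    @[nm --> (\oo, \oo)] --> (0 : R).
  rewrite -[X in _ --> X](mul0r (p x (T x) / (1 - c))).
  apply: cvgM; last exact: cvg_cst.
  rewrite -[X in _ --> X]addr0; apply: (@cvgD _ _ _ (filter_prod \oo \oo)).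
    exact: cvg_comp cvg_fst c0.
  exact: cvg_comp cvg_snd c0.
apply: squeeze_cvgr (cvg_cst _) lim0; apply: nearW => nm.
by rewrite (pmetric_ge0 hp) orbit_dist_le.
Qed.

(** Passing through [u n.+1 = T (u n)], where [u] is the orbit of [x0], bounds
    [p (T x) x] by [c * p x (u n) + p x (u n.+1)], which tends to [0]. *)
Lemma orbit_limit_fixed x x0 :
  p x x = 0 -> pmetric_cvg p (fun n => iter n T x0) x -> T x = x.
Proof.
move=> pxx0; rewrite /pmetric_cvg pxx0 => ux; apply: pmetric0_eq.
apply/eqP; rewrite eq_le (pmetric_ge0 hp) andbT.
have uSx : p x (iter n.+1 T x0) @[n --> \oo] --> (0 : R).
  by rewrite (cvg_shiftS (fun n => p x (iter n T x0))).
have lim0 : c * p x (iter n T x0) + p x (iter n.+1 T x0) @[n --> \oo] --> (0 : R).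
  rewrite -[X in _ --> X]addr0 -[X in X + _](mulr0 c).
  by apply: cvgD uSx; apply: cvgM ux; exact: cvg_cst.
apply: (cvgr_to_ge lim0); apply: nearW => n.
apply: le_trans (pmetric_weak_triangle _ _ (iter n.+1 T x0)) _.
by rewrite (pmetric_sym hp _ x) lerD2r; exact: hT.
Qed.

Lemma contraction_fixpoint_inj x y : T x = x -> T y = y -> x = y.
Proof.
move=> Tx Ty; apply: pmetric0_eq.
apply/eqP; rewrite eq_le (pmetric_ge0 hp) andbT.
rewrite -(@pmulr_rle0 _ (1 - c)) ?subr_gt0// mulrBl mul1r subr_le0.
by have := hT x y; rewrite Tx Ty.
Qed.

Theorem contraction_unique_fixpoint :
  inhabited X -> zero_complete p -> exists! x, T x = x.
Proof.
move=> [x0] hc; have [x [pxx0 ux]] := hc _ (orbit_dlim0 x0).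
have Tx := orbit_limit_fixed pxx0 ux.
by exists x; split=> // y; exact: contraction_fixpoint_inj.
Qed.

End Contraction.
End PartialMetric.

Section Product.
Variables (R : realType) (X Y : Type) (p : X -> X -> R) (q : Y -> Y -> R).
Hypotheses (hp : partial_metric p) (hq : partial_metric q).

Lemma partial_metric_sum : partial_metric (sum_pmetric p q).
Proof.
split; rewrite /sum_pmetric.
- by move=> z w; rewrite addr_ge0 ?(pmetric_ge0 hp) ?(pmetric_ge0 hq).
- move=> [x y] [u v] /=; split=> [[<- <-] //|[e1 e2]].
  (* Self-distances being minimal, an equality of sums forces
     equality of the summands. *)
  have px := pmetric_self_le hp x u; have qy := pmetric_self_le hq y v.
  have pu := pmetric_self_le hp u x; have qv := pmetric_self_le hq v y.
  rewrite (pmetric_sym hp u) in pu; rewrite (pmetric_sym hq v) in qv.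
  by congr pair; [apply/(pmetric_eq hp) | apply/(pmetric_eq hq)]; split; lra.
- by move=> z w; rewrite lerD ?(pmetric_self_le hp) ?(pmetric_self_le hq).
- by move=> z w; rewrite (pmetric_sym hp) (pmetric_sym hq).
- move=> z w t; have := pmetric_triangle hp z.1 w.1 t.1.
  by have := pmetric_triangle hq z.2 w.2 t.2; lra.
Qed.

Lemma zero_complete_sum :
  zero_complete p -> zero_complete q -> zero_complete (sum_pmetric p q).
Proof.
move=> pc qc u u0.
have u1 : pmetric_dlim p (fst \o u) 0.
  apply: squeeze_cvgr (cvg_cst _) u0; apply: nearW => nm.
  by rewrite (pmetric_ge0 hp) lerDl (pmetric_ge0 hq).
have u2 : pmetric_dlim q (snd \o u) 0.
  apply: squeeze_cvgr (cvg_cst _) u0; apply: nearW => nm.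
  by rewrite (pmetric_ge0 hq) lerDr (pmetric_ge0 hp).
have [x [pxx ux]] := pc _ u1; have [y [qyy uy]] := qc _ u2.
exists (x, y); split; first by rewrite /sum_pmetric /= pxx qyy addr0.
exact: cvgD ux uy.
Qed.

End Product.

Theorem theorem2p1 (R : realType) (X : Type) (p : X -> X -> R)
    (hp : partial_metric_space p) (hcomplete : pmetric_complete p)
    (F : X * X -> X) (k l : R) (hk : 0 <= k) (hl : 0 <= l) (hkl : k + l < 1)
    (hF : forall x y u v : X, p (F (x, y)) (F (u, v)) <= k * p x u + l * p y v) :
  exists! z : X * X, coupled_fixed_point F z.
Proof.
have [[x0] pm] := hp; have zc := complete_zero_complete hcomplete.
pose T (z : X * X) := (F (z.1, z.2), F (z.2, z.1)).
have hT z w : sum_pmetric p p (T z) (T w) <= (k + l) * sum_pmetric p p z w.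
  have := hF z.1 z.2 w.1 w.2; have := hF z.2 z.1 w.2 w.1.
  by rewrite /sum_pmetric /=; lra.
have fixE z : coupled_fixed_point F z <-> T z = z.
  by case: z => x y; split=> [[/= Fx Fy]|[]//]; rewrite /T /= Fx Fy.
have [z [Tz z_uniq]] := contraction_unique_fixpoint (partial_metric_sum pm pm)
  (addr_ge0 hk hl) hkl hT (inhabits (x0, x0)) (zero_complete_sum pm pm zc zc).
by exists z; split=> [|w /fixE]; [exact/fixE | exact: z_uniq].
Qed.
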